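(* Let $G$ be a group, and let $g_1,\ldots,g_n\in G$ be independent random elements chosen according to distributions $\mu_1,\ldots,\mu_n$ on $G$. Let $X=g_1\cdots g_n$, and set $$p_0=\inf_{i,g}\{\mu_i(g): g\in\operatorname{supp}(\mu_i)\},\qquad \rho=\sup_{g\in G}\mathbb{P}(X=g).$$ If $S\subset G$ is a subset of self-translate dimension $\le k$ of complexity $C$, then $$\mathbb{P}(X\in S)\le O_{C,k}\left(p_0^{-1}\rho^{1/(2^{k+1}-1)}\right)$$ provided $p_0\neq 0$. Moreover, if $X_0,\ldots,X_k$ are independent $G$-valued random variables and $\rho_i=\sup_{g\in G}\mathbb{P}(X_i=g)$, then for such $S$ $$\mathbb{P}\left(\prod_{i=0}^k X_i\in S\right)=O_{C,k}\left(\max_{0\le i\le k}\rho_i^{1/2^i}\right),$$ where $\prod_{i=0}^kX_i=X_0X_1\cdots X_k$.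
   Context: Self-translate dimension is defined recursively for subsets $S$ of a group $G$ and a positive integer $C$. All $S$ with $|S|\le C$ have self-translate dimension $\le 0$ of complexity $C$ (and for $k=0$ these are the only ones). For $k\ge1$, $S$ has self-translate dimension $\le k$ of complexity $C$ if one can write $S=S_1\cup\cdots\cup S_C$ such that for all $i$ and all $\operatorname{id}_G\ne g\in G$, the set $S_i\cap gS_i$ has self-translate dimension $\le k-1$ of complexity $C$. $O_{C,k}(\cdot)$ denotes an implied constant depending only on $C$ and $k$. $G$ is regarded as an abstract group; all events considered are assumed measurable (e.g. discrete random variables). *)

(* Defs.v *)
From HB Require Import structures.
From mathcomp Require Import all_boot all_order all_algebra.
From mathcomp Require Import all_classical all_reals all_analysis.

Set Implicit Arguments.
Unset Strict Implicit.
Unset Printing Implicit Defensive.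

Import Order.TTheory GRing.Theory Num.Theory.

Local Open Scope classical_set_scope.
Local Open Scope ring_scope.

Definition left_translate (G : groupType) (g : G) (S : set G) : set G :=
  [set (g * x)%g | x in S].

(* For 0 < C, a set with at most C elements satisfies this for every k:
   take every piece equal to S. *)
Fixpoint self_translate_dim (G : groupType) (C k : nat) (S : set G) : Prop :=
  match k with
  | 0%N => (S #<= `I_C)%card
  | k'.+1 =>
      exists T : 'I_C -> set G,
        S = \bigcup_(i in [set: 'I_C]) T i /\
        forall (i : 'I_C) (g : G), g <> 1%g ->
          self_translate_dim C k' (T i `&` left_translate g (T i))
  end.

HB.mixin Record Measurable_isMeasurableGroup (d : measure_display) G
    & Group G & Measurable d G := {
  measurable_mulg : measurable_fun [set: G * G] (fun x : G * G => (x.1 * x.2)%g);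
  measurable_invg : measurable_fun [set: G] (fun x : G => (x^-1)%g);
  measurable_set1g : measurable [set (1%g : G)]
}.

#[short(type="measurableGroupType")]
HB.structure Definition MeasurableGroup (d : measure_display) :=
  {G of Group G & Measurable d G & Measurable_isMeasurableGroup d G}.

(* The variant in which the pieces are measurable at every level; when every
   subset of G is measurable it coincides with [self_translate_dim]. *)
Fixpoint measurable_self_translate_dim (d : measure_display)
    (G : measurableGroupType d) (C k : nat) (S : set G) : Prop :=
  match k with
  | 0%N => (S #<= `I_C)%card
  | k'.+1 =>
      exists T : 'I_C -> set G,
        [/\ forall i, measurable (T i),
            S = \bigcup_(i in [set: 'I_C]) T i &
            forall (i : 'I_C) (g : G), g <> 1%g ->
              measurable_self_translate_dim C k'
                (T i `&` left_translate g (T i))]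
  end.

Section random_elements.
Context {d : measure_display} {Omega : measurableType d} {R : realType}.
Variable P : probability Omega R.

Definition discrete_random_element (G : Type) (X : Omega -> G) : Prop :=
  countable (range X) /\ forall g : G, measurable (X @^-1` [set g]).

(* Mutual independence with respect to the events [X i \in A], A in M.  When
   M contains the whole space, the product rule for subfamilies is the case
   where some of the A i are the whole space. *)
Definition independent_elements (G : Type) (M : set_system G) (n : nat)
    (X : 'I_n -> Omega -> G) : Prop :=
  forall A : 'I_n -> set G, (forall i, M (A i)) ->
    P (\bigcap_(i in [set: 'I_n]) (X i @^-1` A i)) =
    (\prod_(i < n) P (X i @^-1` A i))%E.

Definition point_mass (G : Type) (X : Omega -> G) (g : G) : R :=
  fine (P (X @^-1` [set g])).

Definition max_point_mass (G : Type) (X : Omega -> G) : R :=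
  sup (range (point_mass X)).

(* The set of atoms: the support of the law of X when X is discrete. *)
Definition supp (G : Type) (X : Omega -> G) : set G :=
  [set g | point_mass X g != 0].

(* The infimum is a real number; it is 0 for the empty family (n = 0). *)
Definition min_point_mass (G : Type) (n : nat) (X : 'I_n -> Omega -> G) : R :=
  inf (\bigcup_(i in [set: 'I_n]) (point_mass (X i) @` supp (X i))).

Definition ordered_product (G : groupType) (n : nat) (X : 'I_n -> Omega -> G) :
    Omega -> G :=
  fun w => \big[*%g/1%g]_(i < n) X i w.

End random_elements.

(* Main.v *)
Require Import Defs.
From HB Require Import structures.
From mathcomp Require Import all_boot all_order all_algebra.
From mathcomp Require Import all_classical all_reals all_analysis.
From mathcomp Require Import measurable_realfun ring lra.

(** The heart of the matter is a second-moment inequality.  Let A and V be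
    independent with laws m and l, let T be a set of group elements, and put
    x = P(A V \in T).  If A' is a further copy of A independent of both,
    Cauchy-Schwarz in V gives x ^ 2 <= P(A V \in T and A' V \in T).  On A = A'
    this costs at most r x, where r is the largest point mass of A; off the
    diagonal, a V and b V both lie in T exactly when a V lies in the
    intersection of T with its translate by a / b, so that
    x ^ 2 <= r x + L as soon as every such event for V has probability at
    most L ([kovari_sos_turan], [conv_sqr_le]).  Keeping the factor x in the
    diagonal term, instead of bounding it by 1, is what makes the exponent of
    the first factor equal to 1 rather than 1 / 2.

    Now let S have self-translate dimension k + 1 and let X_0, ..., X_(k+1) be
    independent with largest point masses at most M ^ (2 ^ i).  For a piece T
    of S, the intersections of T with its translates have dimension k, and so
    have their left translates; by induction the product X_1 ... X_(k+1) hits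
    each of them with probability O(M ^ 2).  The second-moment inequality then
    reads x ^ 2 <= M x + O(M ^ 2), whence x = O(M) ([convs_flatten_le]).
    Taking for M the maximum of the rho_i ^ (1 / 2 ^ i) gives the bound for
    one factor more than the dimension.

    For a product of n factors whose largest point masses are all at least p,
    the factors are grouped into k + 1 consecutive blocks.  Set
    q = rho ^ (1 / (2 ^ (k + 1) - 1)) / p; one may assume q < 1.  Lengthening a
    block by one factor divides its largest point mass by at most 1 / p,
    so the shortest block with largest point mass at most t has it at least
    p t ([prefix_split]).  Largest point masses are supermultiplicative under
    convolution ([max_point_mass_conv]), hence cutting off such a block
    multiplies the largest point mass of what remains by at most 1 / (p t).
    As the product of the p q ^ (2 ^ i) for i <= k is at least rho, one can cut
    off blocks for the thresholds q ^ (2 ^ i) in turn ([threshold_split]), and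
    for a set of dimension k that bound applies with M = q.

    All of this is carried out for laws on a measurable group, products of
    independent variables being turned into convolutions by uniqueness of
    product measures ([independent_product_law]).  On an uncountable group in
    which every set is declared measurable, multiplication need not be
    measurable for the product sigma-algebra; discrete random elements are
    therefore first moved to the countable subgroup generated by their
    values, where this problem disappears. *)

Set Implicit Arguments.
Unset Strict Implicit.
Unset Printing Implicit Defensive.

Import Order.TTheory GRing.Theory Num.Theory.

Local Open Scope classical_set_scope.
Local Open Scope ring_scope.

(** * A second-moment inequality *)

Section second_moment.
Local Open Scope ereal_scope.
Context {d1 d2 : measure_display} {T1 : measurableType d1}
  {T2 : measurableType d2} {R : realType}.
Variables (m : probability T1 R) (l : probability T2 R).

Lemma product_measure_ysection (E : set (T1 * T2)) : measurable E ->
  (m \x l) E = \int[l]_y m (ysection E y).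
Proof.
move=> mE; apply: (product_measure_unique (m' := m \x^ l)) => // A B mA mB.
exact: product_measure2E.
Qed.

(** Jensen's inequality for the square; it follows by integrating
    2 x f <= f ^ 2 + x ^ 2. *)
Lemma sqr_integral_le (f : T2 -> \bar R) (x : R) :
  measurable_fun [set: T2] f ->
  (forall y, 0 <= f y) -> (forall y, f y \is a fin_num) ->
  \int[l]_y f y = x%:E -> (x * x)%:E <= \int[l]_y (f y * f y).
Proof.
move=> mf f0 ff fx.
have x0 : (0 <= x)%R by rewrite -lee_fin -fx; apply: integral_ge0.
have mff : measurable_fun setT (fun y => f y * f y) by exact: emeasurable_funM.
have : \int[l]_y ((x + x)%:E * f y) <= \int[l]_y (f y * f y + (x * x)%:E).
  apply: ge0_le_integral => //.
  - by move=> y _; rewrite mule_ge0// lee_fin addr_ge0.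
  - exact: measurable_funeM.
  - exact: emeasurable_funD.
  - move=> y _; rewrite -(fineK (ff y)) -!EFinM -EFinD lee_fin -subr_ge0.
    by rewrite (_ : _ - _ = (fine (f y) - x) ^+ 2)%R ?sqr_ge0//; ring.
rewrite ge0_integralZl//; last by rewrite lee_fin addr_ge0.
rewrite ge0_integralD//; last 2 first.
- by move=> y _; rewrite mule_ge0.
- by move=> y _; rewrite lee_fin mulr_ge0.
rewrite integral_cst//= probability_setT mule1 fx -EFinM mulrDl EFinD.
by rewrite leeD2rE.
Qed.

(** The measure-theoretic form of the Kovari-Sos-Turan bound on the number of
    edges of a bipartite graph E in which two distinct left vertices have few
    common neighbours.  The square of the edge density is at most the second
    moment of the degrees of right vertices, which counts paths a - y - b; the
    paths with a = b contribute at most r times the edge density. *)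
Lemma kovari_sos_turan (E : set (T1 * T2)) (r L : R) :
  measurable E -> (forall a : T1, measurable [set a]) ->
  (forall a, m [set a] <= r%:E) ->
  (forall a b, a <> b -> l (xsection E a `&` xsection E b) <= L%:E) ->
  (0 <= L)%R ->
  (m \x l) E * (m \x l) E <= r%:E * (m \x l) E + L%:E.
Proof.
move=> mE m1 mr lL L0.
have r0 : (0 <= r)%R.
  by rewrite -lee_fin; apply: le_trans (mr point); exact: measure_ge0.
pose f y := m (ysection E y).
have mf : measurable_fun setT f by exact: measurable_fun_ysection.
have f0 y : 0 <= f y by exact: measure_ge0.
have ffin y : f y \is a fin_num.
  by rewrite fin_num_measure//; exact: measurable_ysection.
have xfin : (m \x l) E \is a fin_num.
  by have := fin_num_measure (m \x l : probability _ R); apply.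
rewrite -(fineK xfin) -EFinM.
apply: le_trans.
  apply: (sqr_integral_le mf f0 ffin).
  by rewrite fineK// product_measure_ysection.
(* The second moment of the degree f is the integral of f over the edges;
   Tonelli exchanges the order so as to sum over the left end a first. *)
pose h (z : T1 * T2) := (\1_E z)%:E * f z.2.
have mh : measurable_fun setT h.
  apply: emeasurable_funM; first exact/measurable_EFinP.
  exact: measurableT_comp.
have h0 z : 0 <= h z by rewrite mule_ge0// lee_fin.
rewrite [leLHS](_ : _ = \int[l]_y \int[m]_x h (x, y)); last first.
  apply: eq_integral => y _; rewrite /h /=.
  under eq_integral do rewrite muleC.
  rewrite ge0_integralZl//; last first.
    apply/measurable_EFinP; exact: measurableT_comp.
  congr (_ * _).
  by rewrite -[RHS]/(fubini_G m (EFin \o \1_E) y) indic_fubini_tonelli_GE.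
rewrite -fubini_tonelli//.
pose s a := l (xsection E a).
have ms : measurable_fun [set: T1] s by exact: measurable_fun_xsection.
have s0 a : 0 <= s a by exact: measure_ge0.
apply: (@le_trans _ _ (\int[m]_a (r%:E * s a + L%:E))); last first.
  rewrite ge0_integralD//; first last.
  - exact: measurable_funeM.
  - by move=> a _; rewrite mule_ge0.
  by rewrite ge0_integralZl// integral_cst//= probability_setT mule1 fineK.
apply: ge0_le_integral => //.
- by move=> a _; apply: integral_ge0.
- exact: measurable_fun_fubini_tonelli_F.
- apply: emeasurable_funD => //; exact: measurable_funeM.
move=> a _.
have mEa : measurable (xsection E a) by exact: measurable_xsection.
have mB : measurable (E `&` setT `*` xsection E a).
  by apply: measurableI => //; exact: measurableX.
(* For fixed a, a second exchange turns the integral of f over the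
   neighbours of a into the integral over b of the measure of the common
   neighbours of a and b. *)
rewrite [leLHS](_ : _ = \int[l]_y m (ysection (E `&` setT `*` xsection E a) y)).
  rewrite -product_measure_ysection//.
  rewrite -[leLHS]/(\int[m]_b l (xsection (E `&` setT `*` xsection E a) b)).
  have sE b : xsection E b `&` xsection E a =
      xsection (E `&` setT `*` xsection E a) b.
    by rewrite xsectionI in_xsectionX// inE.
  have -> : \int[m]_b l (xsection (E `&` setT `*` xsection E a) b) =
      \int[m]_b l (xsection E b `&` xsection E a).
    by apply: eq_integral => b _; rewrite sE.
  apply: (@le_trans _ _ (\int[m]_b (s a * (\1_[set a] b)%:E + L%:E))).
    apply: ge0_le_integral => //.
    - under eq_fun do rewrite sE.
      exact: measurable_fun_xsection.
    - apply: emeasurable_funD => //; apply: measurable_funeM.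
      exact/measurable_EFinP.
    - move=> b _; rewrite indicE; have [->|/eqP ab] := eqVneq b a.
        by rewrite mem_set// mule1 setIid leeDl.
      by rewrite memNset ?mule0 ?add0e; [exact: lL|].
  rewrite ge0_integralD//; first last.
  - apply: measurable_funeM; exact/measurable_EFinP.
  - by move=> b _; rewrite mule_ge0.
  rewrite ge0_integralZl//; last exact/measurable_EFinP.
  rewrite integral_indic// setIT integral_cst//= probability_setT mule1.
  by rewrite leeD2r// muleC lee_wpmul2r.
apply: eq_integral => y _; rewrite /h/= /f indicE ysectionI -mem_xsection.
have [yE|yE] := boolP (y \in xsection E a).
  by rewrite in_ysectionX// setIT mul1e.
by rewrite notin_ysectionX// setI0 measure0 mul0e.
Qed.
End second_moment.

(** * Measurable groups *)

Lemma left_translateE (G : groupType) (g : G) (S : set G) :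
  left_translate g S = (fun x => g^-1 * x)%g @^-1` S.
Proof.
apply/seteqP; split => x /=; first by case=> y Sy <-; rewrite mulKg.
by move=> Sx; exists (g^-1 * x)%g => //; rewrite mulVKg.
Qed.

Section measurable_group.
Context {dG : measure_display} {G : measurableGroupType dG}.

Definition mulgp (x : G * G) : G := (x.1 * x.2)%g.

HB.instance Definition _ :=
  isMeasurableFun.Build _ _ _ _ mulgp (@measurable_mulg dG G).

Lemma measurable_mulgl (a : G) :
  measurable_fun [set: G] (fun x : G => (a * x)%g).
Proof.
rewrite (_ : (fun x => _) = mulgp \o (fun x => (a, x)))//.
exact: (measurableT_comp (@measurable_mulg dG G) (pair1_measurable a)).
Qed.

Lemma measurable_preimage_mulgl (a : G) (S : set G) : measurable S ->
  measurable ((fun x => a * x)%g @^-1` S).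
Proof.
by move=> mS; rewrite -[X in measurable X]setTI; exact: measurable_mulgl.
Qed.

Lemma measurable_set1_group (g : G) : measurable [set g].
Proof.
rewrite (_ : [set g] = (fun x => g^-1 * x)%g @^-1` [set 1%g]).
  apply: measurable_preimage_mulgl; exact: measurable_set1g.
apply/seteqP; split => x /=; first by move=> ->; rewrite mulVg.
by move/eqP; rewrite -(mulVg g) => /eqP /mulgI.
Qed.

(** This is where self-translates enter: a x and b x both lie in T if and only
    if a x lies in T and in the translate of T by a / b. *)
Lemma mulgl_preimageI (a b : G) (T : set G) :
  (fun x => a * x)%g @^-1` T `&` (fun x => b * x)%g @^-1` T =
  (fun x => a * x)%g @^-1` (T `&` left_translate (a * b^-1)%g T).
Proof.
rewrite left_translateE; apply/seteqP; split => x /=.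
  by rewrite invgM invgK mulgA mulgVK.
by rewrite invgM invgK mulgA mulgVK.
Qed.

(** Translating T on the left by the inverse of a conjugates by a the
    translations that T is intersected with, and conjugation fixes only the
    trivial one. *)
Lemma measurable_self_translate_dim_mulgl (C k : nat) (a : G) (S : set G) :
  measurable_self_translate_dim C k S ->
  measurable_self_translate_dim C k ((fun x => a * x)%g @^-1` S).
Proof.
elim: k S => [|k IH] S /=.
  apply: card_le_trans.
  rewrite (_ : _ @^-1` S = (fun x => a^-1 * x)%g @` S) ?card_image_le//.
  by have := left_translateE (a^-1)%g S; rewrite invgK => <-.
case=> T [mT -> hT]; exists (fun i => (fun x => a * x)%g @^-1` (T i)).
split => [i|//|i g g1].
- exact: measurable_preimage_mulgl.
- rewrite (_ : _ `&` _ = (fun x => a * x)%g @^-1`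
      (T i `&` left_translate (a * g * a^-1)%g (T i))).
    apply/IH/hT => /(congr1 (fun x => a^-1 * x * a)%g).
    by rewrite !mulgA mulVg mul1g mulgVK mulg1 mulVg.
  rewrite !left_translateE; apply/seteqP; split => x /=;
  by rewrite !invgM invgK !mulgA mulgVK.
Qed.

Lemma measure_card_le (R : realType) (m : probability G R) (r : R) (C : nat)
    (S : set G) : (forall g, m [set g] <= r%:E)%E -> (S #<= `I_C)%card ->
  (m S <= (C%:R * r)%:E)%E.
Proof.
move=> mr SC; have fS : finite_set S by apply/finite_set_leP; exists C.
have r0 : 0 <= r.
  by rewrite -lee_fin; apply: le_trans (mr 1%g); exact: measure_ge0.
have {1}-> : S = \bigcup_(g in S) [set g] by rewrite bigcup_imset1 image_id.
rewrite measure_fin_bigcup//; last 2 first.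
- by move=> g h _ _ [x [/= -> ->]].
- by move=> g _; exact: measurable_set1_group.
rewrite fsbig_finite//=.
apply: le_trans.
  by apply: lee_sum => g _; exact: (mr g).
rewrite sumEFin lee_fin big_const_seq count_predT iter_addr_0 -[leLHS]mulr_natl.
by rewrite ler_wpM2r// ler_nat geq_card_fset_set.
Qed.

End measurable_group.

(** * Largest point masses *)

Section max_point_mass.
Context {d : measure_display} {Omega : measurableType d} {R : realType}.
Variables (P : probability Omega R) (G : Type) (X : Omega -> G).
Hypothesis mX : forall g, measurable (X @^-1` [set g]).

Lemma point_massE g : (point_mass P X g)%:E = P (X @^-1` [set g]).
Proof. by rewrite fineK// fin_num_measure. Qed.

Lemma point_mass_le_max g : point_mass P X g <= max_point_mass P X.
Proof.
apply: ub_le_sup; last by exists g.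
by exists 1 => _ [h _ <-]; rewrite -lee_fin point_massE probability_le1.
Qed.

Lemma probability_le_max g :
  (P (X @^-1` [set g]) <= (max_point_mass P X)%:E)%E.
Proof. by rewrite -point_massE lee_fin point_mass_le_max. Qed.

Lemma max_point_mass_ge0 : 0 <= max_point_mass P X.
Proof.
apply: le_trans (point_mass_le_max (X point)).
by rewrite -lee_fin point_massE measure_ge0.
Qed.

Lemma max_point_mass_le r :
  (forall g, (P (X @^-1` [set g]) <= r%:E)%E) -> max_point_mass P X <= r.
Proof.
move=> Pr; apply: ge_sup; first by exists (point_mass P X (X point)), (X point).
by move=> _ [g _ <-]; rewrite -lee_fin point_massE.
Qed.

End max_point_mass.

(** * Convolution of laws *)

Section convolution.
Context {dG : measure_display} {G : measurableGroupType dG} {R : realType}.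
Implicit Types (m l h : probability G R) (s : seq (probability G R)).
Implicit Types S : set G.

Definition conv m l : probability G R :=
  distribution (m \x l : probability _ R)%E mulgp.

Definition dirac1 : probability G R := \d_(1%g : G).

Definition convs s : probability G R := foldr conv dirac1 s.

Lemma xsection_mulgp S a :
  xsection (mulgp @^-1` S) a = (fun x => a * x)%g @^-1` S.
Proof. by rewrite xsectionE. Qed.

Lemma convE m l S :
  (conv m l S = \int[m]_a l ((fun x => a * x)%g @^-1` S))%E.
Proof. by apply: eq_integral => a _; rewrite /= xsection_mulgp. Qed.

Lemma measurable_mulgp_preimage S : measurable S -> measurable (mulgp @^-1` S).
Proof.
by move=> mS; rewrite -[X in measurable X]setTI; exact: measurable_mulg.
Qed.

Lemma measurable_fun_mulgl_measure l S : measurable S ->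
  measurable_fun [set: G] (fun a => l ((fun x => a * x)%g @^-1` S)).
Proof.
move=> mS; under eq_fun do rewrite -xsection_mulgp.
apply: measurable_fun_xsection; exact: measurable_mulgp_preimage.
Qed.

(** Equality is asserted on measurable sets only: elsewhere the two product
    measures have arbitrary values. *)
Lemma convA m l h S : measurable S ->
  conv (conv m l) h S = conv m (conv l h) S.
Proof.
move=> mS; have mf := measurable_fun_mulgl_measure h mS.
rewrite [LHS]convE [LHS]ge0_integral_distribution//.
rewrite [LHS]fubini_tonelli1//; last exact: measurableT_comp.
rewrite convE; apply: eq_integral => a _; rewrite convE.
apply: eq_integral => b _ /=; congr (h _).
by apply/funext => x /=; rewrite mulgA.
Qed.

Lemma conv1m l S : measurable S -> conv dirac1 l S = l S.
Proof.
move=> mS; rewrite convE integral_dirac//; last first.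
  exact: measurable_fun_mulgl_measure.
rewrite diracT mul1e; congr (l _).
by apply/funext => x /=; rewrite mul1g.
Qed.

Lemma convm1 m S : measurable S -> conv m dirac1 S = m S.
Proof.
move=> mS; rewrite convE -[S in RHS]setIT -integral_indic//.
apply: eq_integral => a _; rewrite /= diracE indicE; congr (_%:R)%:E.
by congr (nat_of_bool _); apply/idP/idP; rewrite !inE/= mulg1.
Qed.

Lemma convs_cat s1 s2 S : measurable S ->
  convs (s1 ++ s2) S = conv (convs s1) (convs s2) S.
Proof.
elim: s1 S => [|m s1 IH] S mS; first exact/esym/conv1m.
apply: etrans (esym (convA m _ _ mS)).
rewrite [LHS]convE [RHS]convE; apply: eq_integral => a _ /=.
exact/IH/measurable_preimage_mulgl.
Qed.

Lemma convs1 m S : measurable S -> convs [:: m] S = m S.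
Proof. exact: convm1. Qed.

Let measurable_id1 (g : G) : measurable ((@id G) @^-1` [set g]).
Proof. exact: measurable_set1_group. Qed.

Lemma law_le_max m g : (m [set g] <= (max_point_mass m id)%:E)%E.
Proof. exact: (@probability_le_max _ _ _ m _ id measurable_id1 g). Qed.

Lemma law_max_ge0 m : 0 <= max_point_mass m id.
Proof. exact: (@max_point_mass_ge0 _ _ _ m _ id measurable_id1). Qed.

(** If a and b carry the largest point masses of m and l, then a b has at
    least their product; the suprema are handled one at a time. *)
Lemma max_point_mass_conv m l :
  max_point_mass m id * max_point_mass l id <= max_point_mass (conv m l) id.
Proof.
set M := max_point_mass (conv m l) id.
have ab a b : point_mass m id a * point_mass l id b <= M.
  rewrite -lee_fin EFinM !point_massE//.
  apply: le_trans
    (@probability_le_max _ _ _ (conv m l) _ id measurable_id1 (a * b)%g).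
  rewrite -product_measure1E//.
  apply: le_measure; rewrite ?inE.
  - by apply: measurableX; exact: measurable_id1.
  - exact: measurable_mulgp_preimage.
  - by move=> [x y] [/= -> ->].
have M0 : 0 <= M by exact: max_point_mass_ge0.
have sup_mul (k : probability G R) y : 0 <= y ->
    (forall a, point_mass k id a * y <= M) -> max_point_mass k id * y <= M.
  rewrite le_eqVlt => /predU1P[<-|y0]; first by rewrite mulr0.
  move=> ky; rewrite -ler_pdivlMr//; apply: max_point_mass_le => // g.
  by rewrite -point_massE// lee_fin ler_pdivlMr.
apply: (sup_mul m) => [|a]; first exact: max_point_mass_ge0.
rewrite mulrC; apply: (sup_mul l) => [|b].
  by rewrite -lee_fin point_massE.
by rewrite mulrC.
Qed.

Lemma conv_sqr_le m l T (r L : R) : measurable T ->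
  (forall a, m [set a] <= r%:E)%E -> 0 <= L ->
  (forall g a : G, g <> 1%g ->
    (l ((fun x => a * x)%g @^-1` (T `&` left_translate g T)) <= L%:E)%E) ->
  (conv m l T * conv m l T <= r%:E * conv m l T + L%:E)%E.
Proof.
move=> mT mr L0 lL; apply: kovari_sos_turan => //.
- exact: measurable_mulgp_preimage.
- move=> a b ab; rewrite !xsection_mulgp mulgl_preimageI; apply: lL.
  by move/(congr1 (fun x => x * b)%g); rewrite mulgVK mul1g.
Qed.

End convolution.

(** * The bound for k + 1 blocks of factors *)

Section counting_bound.
Context {dG : measure_display} {G : measurableGroupType dG} {R : realType}.
Implicit Types (m l : probability G R) (s : seq (probability G R)).
Implicit Types (ss : seq (seq (probability G R))) (S : set G) (p q t M : R).

Lemma bigcup_ord_le m (C : nat) (T : 'I_C -> set G) (r : R) :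
  (forall i, measurable (T i)) -> (forall i, m (T i) <= r%:E)%E ->
  (m (\bigcup_(i in [set: 'I_C]) T i) <= (C%:R * r)%:E)%E.
Proof.
move=> mT Tr; have -> : [set: 'I_C] = [set` enum 'I_C].
  by apply/seteqP; split => i //= _; rewrite mem_enum.
rewrite bigcup_seq -[in X in (_ <= X)%E](size_enum_ord C).
elim: (enum _) => [|i e IH]; first by rewrite big_nil measure0 mul0r.
rewrite big_cons /= -natr1 mulrDl mul1r EFinD addeC.
apply: (@le_trans _ _ (m (T i) + m (\big[setU/set0]_(j <- e) T j))%E).
  by apply: measureU2 => //; exact: bigsetU_measurable.
exact: leeD.
Qed.

(** Each of the C pieces costs 1 + K by [quadratic_bound], where K is the
    constant for its intersections with its translates. *)
Fixpoint dim_constant (C k : nat) : nat :=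
  if k is k'.+1 then (C * (dim_constant C k').+1)%N else C.

Lemma quadratic_bound (x M K : R) : 0 <= M -> 0 <= K ->
  x * x <= M * x + K * M ^+ 2 -> x <= (1 + K) * M.
Proof.
move=> M0 K0 xx; rewrite leNgt; apply/negP => Kx.
pose y := x - (1 + K) * M; have y0 : 0 < y by rewrite subr_gt0.
have xE : x = (1 + K) * M + y by rewrite addrC subrK.
have yy : 0 < y * y by rewrite mulr_gt0.
have yM : 0 <= y * M by rewrite mulr_ge0// ltW.
have yKM : 0 <= K * (y * M) by rewrite mulr_ge0.
have KM2 : 0 <= (K * M) ^+ 2 by exact: sqr_ge0.
by move: xx; rewrite xE; lra.
Qed.

(** The factors come grouped in k + 1 blocks, so that one statement serves
    both independent factors (blocks of length 1) and long products.  The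
    thresholds M ^ (2 ^ i) are those for which removing the first block
    amounts to replacing M by M ^ 2. *)
Lemma convs_flatten_le (C k : nat) S ss M :
  0 <= M -> measurable S -> measurable_self_translate_dim C k S ->
  size ss = k.+1 ->
  (forall i, (i < k.+1)%N ->
    max_point_mass (convs (nth [::] ss i)) id <= M ^+ (2 ^ i)) ->
  (convs (flatten ss) S <= ((dim_constant C k)%:R * M)%:E)%E.
Proof.
elim: k S ss M => [|k IH] S [//|s ss] M M0 mS dS /= [].
  move=> /size0nil ->; rewrite cats0 => /(_ 0%N isT) /= sM.
  apply: measure_card_le dS => g; apply: le_trans (law_le_max _ _) _.
  by rewrite lee_fin.
move=> ssk ssM; rewrite convs_cat//.
case: dS => T [mT -> dT]; set K := dim_constant C k.
rewrite natrM -mulrA; apply: bigcup_ord_le => // i.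
set x := conv _ _ _.
have xfin : x \is a fin_num by exact: fin_num_measure.
have L0 : 0 <= K%:R * M ^+ 2 by rewrite mulr_ge0// sqr_ge0.
have := @conv_sqr_le _ _ _ (convs s) (convs (flatten ss)) (T i) M _ (mT i) _ L0.
rewrite -/x -(fineK xfin) -!EFinM -EFinD !lee_fin => h.
rewrite -natr1 addrC; apply: quadratic_bound => //; apply: h.
  move=> a; apply: le_trans (law_le_max _ _) _.
  by rewrite lee_fin; exact: (ssM 0%N).
move=> g a g1; apply: IH => //.
- exact: sqr_ge0.
- apply: measurable_preimage_mulgl; apply: measurableI => //.
  by rewrite left_translateE; exact: measurable_preimage_mulgl.
- by apply: measurable_self_translate_dim_mulgl; exact: dT.
- by move=> j jk; rewrite -exprM -expnS; exact: (ssM j.+1).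
Qed.

End counting_bound.

(** * Cutting a long product into blocks *)

Section splitting.
Context {dG : measure_display} {G : measurableGroupType dG} {R : realType}.
Implicit Types (m l : probability G R) (s : seq (probability G R)).
Implicit Types (ss : seq (seq (probability G R))) (S : set G) (p q t M : R).

Lemma eq_max_point_mass m l : (forall g, m [set g] = l [set g]) ->
  max_point_mass m id = max_point_mass l id.
Proof.
move=> ml; rewrite /max_point_mass.
suff -> : point_mass m id = point_mass l id :> (G -> R) by [].
by apply/funext => g; rewrite /point_mass preimage_id ml.
Qed.

Lemma max_point_mass_dirac1 : max_point_mass (@dirac1 _ G R) id = 1.
Proof.
apply/eqP; rewrite eq_le; apply/andP; split.
  apply: max_point_mass_le => g; first exact: measurable_set1_group.
  by rewrite -[1%:E]/1%E; apply: probability_le1; exact: measurable_set1_group.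
rewrite -lee_fin; apply: le_trans (law_le_max _ 1%g).
by rewrite /= diracE mem_set.
Qed.

Lemma max_point_mass_convs_cat s1 s2 :
  max_point_mass (convs s1) id * max_point_mass (convs s2) id <=
  max_point_mass (convs (s1 ++ s2)) id.
Proof.
rewrite (@eq_max_point_mass (convs (s1 ++ s2)) (conv (convs s1) (convs s2))).
  exact: max_point_mass_conv.
by move=> g; apply: convs_cat; exact: measurable_set1_group.
Qed.

Lemma max_point_mass_convs1 m :
  max_point_mass (convs [:: m]) id = max_point_mass m id.
Proof.
apply: eq_max_point_mass => g; apply: convs1; exact: measurable_set1_group.
Qed.

Variable p : R.
Hypotheses (p_gt0 : 0 < p) (p_le1 : p <= 1).

Lemma max_point_mass_convs_gt0 s :
  {in s, forall m, p <= max_point_mass m id} -> 0 < max_point_mass (convs s) id.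
Proof.
elim: s => [|m s IH] ps; first by rewrite [ltRHS]max_point_mass_dirac1.
apply: lt_le_trans (max_point_mass_convs_cat [:: m] s).
rewrite max_point_mass_convs1 mulr_gt0//.
  by apply: (lt_le_trans p_gt0); apply: ps; rewrite mem_head.
by apply: IH => l ls; apply: ps; rewrite inE ls orbT.
Qed.

(** The prefix s1 is the shortest one whose largest point mass is at most t:
    its last factor, of largest point mass at least p, brought that mass below
    t, so it cannot have gone below p t.  The empty prefix has largest point
    mass 1, which covers the case t = 1. *)
Lemma prefix_split s t : {in s, forall m, p <= max_point_mass m id} ->
  0 <= t <= 1 -> max_point_mass (convs s) id <= t ->
  exists s1 s2, [/\ s = s1 ++ s2, p * t <= max_point_mass (convs s1) id &
    max_point_mass (convs s1) id <= t].
Proof.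
move=> + /andP[t0 t1].
elim/last_ind: s => [|s m IH] ps st.
  exists [::], [::]; split => //.
  by rewrite [leRHS]max_point_mass_dirac1 mulr_ile1// ltW.
have [st'|ts] := leP (max_point_mass (convs s) id) t.
  have [|s1 [s2 [-> ? ?]]] := IH _ st'.
    by move=> l ls; apply: ps; rewrite mem_rcons inE ls orbT.
  by exists s1, (rcons s2 m); rewrite rcons_cat.
exists (rcons s m), [::]; rewrite cats0; split => //.
rewrite -cats1; apply: le_trans (max_point_mass_convs_cat _ _).
rewrite mulrC max_point_mass_convs1; apply: ler_pM => //.
- exact: ltW.
- exact: ltW.
- by apply: ps; rewrite mem_rcons mem_head.
Qed.

(** Each cut lowers the largest point mass of a block to between p t and t,
    so by supermultiplicativity the remaining factors satisfy the hypothesis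
    for the remaining thresholds.  The last block is all that is left over. *)
Lemma threshold_split (ts : seq R) s :
  {in s, forall m, p <= max_point_mass m id} ->
  {in ts, forall t, 0 < t <= 1} -> (0 < size ts)%N ->
  max_point_mass (convs s) id <= \prod_(t <- ts) (p * t) ->
  exists ss, [/\ flatten ss = s, size ss = size ts &
    forall i, (i < size ts)%N ->
      max_point_mass (convs (nth [::] ss i)) id <= nth 1 ts i].
Proof.
elim: ts s => [//|t ts IH] s ps /[dup] ts1 /(_ t); rewrite mem_head.
move=> /(_ isT)/andP[t_gt0 t_le1] _; rewrite big_cons => st.
have ts1' : {in ts, forall t, 0 < t <= 1}.
  by move=> u uts; apply: ts1; rewrite inE uts orbT.
have [ts0|ts_gt0] := posnP (size ts).
  exists [:: s]; rewrite /= cats0 ts0; split => // -[|//] _ /=.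
  move: st; rewrite (size0nil ts0) big_nil mulr1 => /le_trans; apply.
  by rewrite ler_piMl// ltW.
have prod_ge0 : 0 <= \prod_(u <- ts) (p * u).
  rewrite big_seq; apply: prodr_ge0 => u /ts1' /andP[u0 _].
  by rewrite mulr_ge0// ltW.
have prod_le1 : \prod_(u <- ts) (p * u) <= 1.
  rewrite big_seq; apply: prodr_ile1 => u /ts1' /andP[u0 u1].
  apply/andP; split; first by rewrite mulr_ge0// ltW.
  by rewrite mulr_ile1// ltW.
have [||s1 [s2 [ss12 pt1 t1]]] := @prefix_split s t ps.
- by rewrite t_le1 ltW.
- apply: le_trans st _; rewrite -mulrA -[leRHS]mul1r.
  rewrite ler_pM ?mulr_ge0 ?(ltW p_gt0) ?(ltW t_gt0)//.
  by rewrite ler_piMr// ltW.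
have [||ss [fss sss hss]] := IH s2 _ ts1' ts_gt0.
- by move=> l ls; apply: ps; rewrite ss12 mem_cat ls orbT.
- rewrite -(ler_pM2l (mulr_gt0 p_gt0 t_gt0)); apply: le_trans st.
  apply: le_trans (_ : max_point_mass (convs s1) id *
    max_point_mass (convs s2) id <= _).
    by rewrite ler_wpM2r// law_max_ge0.
  by rewrite ss12 max_point_mass_convs_cat.
exists (s1 :: ss); rewrite /= fss sss; split => // -[|i] //=.
exact: hss.
Qed.

(** For q >= 1 the bound is at least 1.  Otherwise the thresholds q ^ (2 ^ i)
    for i <= k have product q ^ (2 ^ (k + 1) - 1), so the exponent in q is the one
    that makes the thresholds affordable. *)
Lemma convs_le_max_point_mass (C k : nat) S s :
  {in s, forall m, p <= max_point_mass m id} ->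
  measurable S -> measurable_self_translate_dim C k S ->
  (convs s S <= ((1 + (dim_constant C k)%:R) *
    (p^-1 * max_point_mass (convs s) id `^ (2 ^+ k.+1 - 1)^-1))%:E)%E.
Proof.
move=> ps mS dS; set rho := max_point_mass _ _.
pose N := (2 ^ k.+1 - 1)%N.
have N_gt0 : (0 < N)%N by rewrite subn_gt0 -{1}(expn0 2) ltn_exp2l.
have NE : 2 ^+ k.+1 - 1 = N%:R :> R by rewrite natrB ?natrX// expn_gt0.
have rho_gt0 : 0 < rho by exact: max_point_mass_convs_gt0.
rewrite NE; set q := p^-1 * _; set K := dim_constant C k.
have q_gt0 : 0 < q by rewrite mulr_gt0// ?invr_gt0// powR_gt0.
have [q1|q1] := leP 1 q.
  apply: le_trans (probability_le1 _ mS) _; rewrite lee_fin.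
  by rewrite mulr_ege1// lerDl.
have qN : q ^+ N = p^-1 ^+ N * rho.
  rewrite exprMn -[X in _ * X = _]powR_mulrn ?powR_ge0// -powRrM.
  rewrite mulVf ?pnatr_eq0 -?lt0n//.
  by rewrite powRr1// ltW.
pose ts := [seq q ^+ (2 ^ i) | i <- iota 0 k.+1].
have sts : size ts = k.+1 by rewrite size_map size_iota.
have [|||ss [fss sss hss]] := @threshold_split ts s ps.
- move=> _ /mapP[i _ ->]; rewrite exprn_gt0//=.
  by apply: exprn_ile1; rewrite ltW.
- by rewrite sts.
- (* The product of the p q ^ (2 ^ i) is p ^ (k + 1 - N) rho, which is at least
     rho because k + 1 <= N. *)
  have e_exp : exists e, N = (k.+1 + e)%N.
    exists (N - k.+1)%N; rewrite subnKC// /N leq_subRL ?expn_gt0// add1n.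
    exact: ltn_expl.
  have sum2 : (\sum_(i <- iota 0 k.+1) 2 ^ i)%N = N.
    rewrite -[iota _ _]/(index_iota 0 k.+1) /N subn1 predn_exp mul1n.
    by rewrite big_mkord.
  rewrite big_map big_split big_const_seq count_predT size_iota iter_mulr_1.
  rewrite -expr_sum sum2 qN [leRHS]/=; have [e ->] := e_exp.
  rewrite exprD mulrA mulrA -exprMn mulfV ?gt_eqF// expr1n mul1r.
  by apply: ler_peMl; [exact: ltW|rewrite exprn_ege1// invf_ge1].
rewrite -fss; apply: le_trans (_ : (K%:R * q)%:E <= _)%E; last first.
  by rewrite lee_fin ler_wpM2r ?lerDr// ltW.
apply: convs_flatten_le => //; first exact: ltW.
  by rewrite sss.
move=> i ik; apply: le_trans (hss i _) _; rewrite ?sts//.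
by rewrite (nth_map 0%N) ?size_iota// nth_iota.
Qed.

End splitting.

(** * Products of independent random elements *)

Section independence.
Context {dG : measure_display} {G : measurableGroupType dG} {R : realType}.
Context {d : measure_display} {Omega : measurableType d}.
Variable P : probability Omega R.

Lemma measurable_ordered_product (n : nat) (X : 'I_n -> {RV P >-> G}) :
  measurable_fun [set: Omega] (ordered_product X).
Proof.
elim: n X => [|n IH] X.
  rewrite (_ : ordered_product X = cst 1%g)//.
  by apply/funext => w; rewrite /ordered_product big_ord0.
rewrite (_ : ordered_product X = mulgp \o (fun w => (X ord0 w,
    ordered_product (fun i => X (lift ord0 i)) w))); last first.
  by apply/funext => w; rewrite /ordered_product big_ord_recl.
apply: (measurableT_comp (@measurable_mulg _ G)).
by apply: measurable_fun_pair => //; exact: IH.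
Qed.

Definition laws (n : nat) (X : 'I_n -> {RV P >-> G}) : seq (probability G R) :=
  [seq (distribution P (X i) : probability G R) | i <- enum 'I_n].

Lemma size_laws (n : nat) (X : 'I_n -> {RV P >-> G}) : size (laws X) = n.
Proof. by rewrite size_map size_enum_ord. Qed.

Lemma lawsS (n : nat) (X : 'I_n.+1 -> {RV P >-> G}) :
  laws X = (distribution P (X ord0) : probability G R) ::
    laws (fun i => X (lift ord0 i)).
Proof. by rewrite /laws enum_ordSl /= -map_comp. Qed.

(** The event D is what makes the induction run: restricting from D to D and
    X_0 in A keeps the hypothesis for the remaining factors, and thereby shows
    that the joint law of X_0 and X_1 ... X_(n-1) agrees with a multiple of a
    product measure on rectangles. *)
Lemma independent_product_law_on (n : nat) (X : 'I_n -> {RV P >-> G})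
    (D : set Omega) : measurable D ->
  (forall A : 'I_n -> set G, (forall i, measurable (A i)) ->
    P (D `&` \bigcap_(i in [set: 'I_n]) (X i @^-1` A i)) =
    (P D * \prod_(i < n) P (X i @^-1` A i))%E) ->
  forall S, measurable S ->
    (P (D `&` ordered_product X @^-1` S) = P D * convs (laws X) S)%E.
Proof.
elim: n X D => [|n IH] X D mD DX S mS.
  rewrite /laws (size0nil (size_enum_ord 0)) /= diracE.
  rewrite (_ : ordered_product X = cst 1%g); last first.
    by apply/funext => w; rewrite /ordered_product big_ord0.
  rewrite preimage_cst; case: ifPn => S1; first by rewrite setIT mule1.
  by rewrite setI0 measure0 mule0.
rewrite lawsS; set m : probability G R := distribution P (X ord0).
set l := convs (laws (fun i => X (lift ord0 i))).
rewrite -[convs _]/(conv m l).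
set V := ordered_product (fun i => X (lift ord0 i)).
have mV : measurable_fun [set: Omega] V by exact: measurable_ordered_product.
have DXV A B : measurable A -> measurable B ->
    (P (D `&` (X ord0 @^-1` A `&` V @^-1` B)) = P D * (m A * l B))%E.
  move=> mA mB.
  have mXA : measurable (X ord0 @^-1` A) by exact: measurable_funPTI.
  have DXA (A' : 'I_n -> set G) : (forall i, measurable (A' i)) ->
      (P (D `&` X ord0 @^-1` A `&`
          \bigcap_(i in [set: 'I_n]) (X (lift ord0 i) @^-1` A' i)) =
       P D * (m A * \prod_(i < n) P (X (lift ord0 i) @^-1` A' i)))%E.
    move=> mA'.
    pose A'' i := if unlift ord0 i is Some j then A' j else A.
    have := DX A''; rewrite big_ord_recl /A'' unlift_none.
    under eq_bigr do rewrite liftK.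
    move=> <-; last by move=> i; case: unliftP.
    congr (P _); rewrite -setIA; congr (_ `&` _).
    apply/seteqP; split => w.
      by move=> [wA wA'] i _ /=; case: unliftP => [j|] -> //; exact: wA'.
    move=> wA; split; first by have := wA ord0 I; rewrite /= unlift_none.
    by move=> i _; have := wA (lift ord0 i) I; rewrite /= liftK.
  have DA : (P (D `&` X ord0 @^-1` A) = P D * m A)%E.
    have := DXA (fun=> setT) (fun=> measurableT).
    rewrite bigcapT// setIT => ->.
    by rewrite big1 ?mule1// => i _; rewrite preimage_setT probability_setT.
  rewrite setIA IH//; first by rewrite DA muleA.
    exact: measurableI.
  by move=> A' mA'; rewrite DXA// DA muleA.
have PDfin : P D \is a fin_num by exact: fin_num_measure.
have [PD0|PD0] := eqVneq (P D) 0%E.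
  rewrite PD0 mul0e; apply/eqP; rewrite -measure_le0 -PD0.
  apply: le_measure; rewrite ?inE//; apply: measurableI => //.
  rewrite -[X in measurable X]setTI; exact: measurable_ordered_product.
(* When P D > 0, the law of (X_0, V) conditioned on D is a product measure. *)
pose W w := (X ord0 w, V w).
have mW : measurable_fun [set: Omega] W by exact: measurable_fun_pair.
have c0 : 0 <= (fine (P D))^-1 by rewrite invr_ge0 fine_ge0.
have PDK : ((fine (P D))^-1%:E * P D = 1)%E.
  by rewrite -{2}(fineK PDfin) -EFinM mulVf// fine_eq0.
rewrite -[conv m l S]/((m \x l)%E (mulgp @^-1` S)).
have := @product_measure_unique _ _ _ _ _ m l
  (mscale (NngNum c0) (pushforward (mrestr P mD) W)).
move=> /(_ mW _ (mulgp @^-1` S) (measurable_mulgp_preimage mS)) ->.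
  transitivity (P D * ((fine (P D))^-1%:E *
      P (W @^-1` (mulgp @^-1` S) `&` D)))%E => //.
  rewrite muleA [(P D * _)%E]muleC PDK mul1e setIC.
  congr (P (_ `&` _)); apply/seteqP.
  by split => w /=; rewrite /ordered_product big_ord_recl.
move=> A B mA mB.
transitivity ((fine (P D))^-1%:E *
  P ((X ord0 @^-1` A `&` V @^-1` B) `&` D))%E => //.
by rewrite setIC DXV// muleA PDK mul1e.
Qed.

Lemma independent_product_law (n : nat) (X : 'I_n -> {RV P >-> G}) :
  independent_elements P (@measurable dG G) X ->
  forall S, measurable S -> P (ordered_product X @^-1` S) = convs (laws X) S.
Proof.
move=> indX S mS; rewrite -[LHS](congr1 P (setTI _)).
rewrite independent_product_law_on ?probability_setT ?mul1e// => A mA.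
by rewrite setTI mul1e; exact: indX.
Qed.

Lemma ordered_product_le_factors (C k : nat) (S : set G)
    (X : 'I_k.+1 -> {RV P >-> G}) :
  measurable S -> measurable_self_translate_dim C k S ->
  independent_elements P (@measurable dG G) X ->
  (P (ordered_product X @^-1` S) <=
   ((dim_constant C k)%:R * \big[Num.max/0]_(i < k.+1)
      (max_point_mass P (X i) `^ (2 ^+ i)^-1))%:E)%E.
Proof.
move=> mS dS indX; rewrite independent_product_law//.
set M := \big[_/_]_(_ < _) _.
have M0 : 0 <= M by exact: bigmax_ge_id.
rewrite -(flatten_seq1 (laws X)); apply: convs_flatten_le => //.
  by rewrite size_map size_laws.
move=> i ik; rewrite (nth_map (@dirac1 _ G R)) ?size_laws//.
rewrite max_point_mass_convs1 (nth_map ord0) ?size_enum_ord//.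
set j := nth _ _ _; have ji : j = i :> nat by rewrite nth_enum_ord.
rewrite -ji -[max_point_mass _ _]/(max_point_mass P (X j)).
set r := max_point_mass _ _.
have r0 : 0 <= r.
  apply: max_point_mass_ge0 => g; apply: measurable_funPTI => //.
  exact: measurable_set1_group.
have -> : r = (r `^ (2 ^+ j)^-1) ^+ (2 ^ j).
  by rewrite -powR_mulrn ?powR_ge0// -powRrM natrX mulVf ?expf_neq0// powRr1.
rewrite lerXn2r ?nnegrE ?powR_ge0//.
exact: (le_bigmax _ (fun i : 'I_k.+1 => max_point_mass P (X i) `^ (2 ^+ i)^-1)).
Qed.

Lemma ordered_product_le_total (C k n : nat) (S : set G)
    (X : 'I_n -> {RV P >-> G}) (p : R) :
  0 < p <= 1 -> (forall i, p <= max_point_mass P (X i)) ->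
  measurable S -> measurable_self_translate_dim C k S ->
  independent_elements P (@measurable dG G) X ->
  (P (ordered_product X @^-1` S) <=
   ((1 + (dim_constant C k)%:R) *
     (p^-1 * max_point_mass P (ordered_product X) `^ (2 ^+ k.+1 - 1)^-1))%:E)%E.
Proof.
move=> /andP[p0 p1] pX mS dS indX; rewrite independent_product_law//.
have -> : max_point_mass P (ordered_product X) =
    max_point_mass (convs (laws X)) id.
  rewrite /max_point_mass; suff -> : point_mass P (ordered_product X) =
    point_mass (convs (laws X)) id :> (G -> R) by [].
  apply/funext => g; rewrite /point_mass preimage_id independent_product_law//.
  exact: measurable_set1_group.
apply: convs_le_max_point_mass => // _ /mapP[i _ ->]; exact: pX.
Qed.

End independence.

(** * Discrete random elements *)

Section countable_subgroup.
Variables (G : groupType) (e : nat -> G).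

(** The Boolean tells whether a letter or its inverse is meant. *)
Definition signed_word (l : seq (nat * bool)) : G :=
  \big[*%g/1%g]_(x <- l) (if x.2 then e x.1 else (e x.1)^-1)%g.

Definition generated : pred G := fun x => `[< range signed_word x >].

Lemma group_closed_generated : group_closed generated.
Proof.
have gM : {in generated &, forall x y, (x * y)%g \in generated}.
  move=> _ _ /asboolP[l1 _ <-] /asboolP[l2 _ <-]; apply/asboolP.
  by exists (l1 ++ l2) => //; rewrite /signed_word big_cat.
have gV : {in generated, forall x, (x^-1)%g \in generated}.
  move=> _ /asboolP[l _ <-]; elim: l => [|[n b] l IH].
    by apply/asboolP; exists [::] => //; rewrite /signed_word big_nil invg1.
  rewrite /signed_word big_cons invgM; apply: gM => //.
  apply/asboolP; exists [:: (n, ~~ b)] => //.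
  by rewrite /signed_word big_seq1 /=; case: b; rewrite //= invgK.
split; first by apply/asboolP; exists [::] => //; rewrite /signed_word big_nil.
by move=> x y gx gy; apply: gM => //; apply: gV.
Qed.

Definition gen_subgroup := {x : G | generated x}.

HB.instance Definition _ := SubType.on gen_subgroup.
HB.instance Definition _ := [Choice of gen_subgroup by <:].
HB.instance Definition _ := SubChoice_isSubGroup.Build G generated gen_subgroup
  group_closed_generated.
HB.instance Definition _ := isPointed.Build gen_subgroup 1%g.
HB.instance Definition _ := @isMeasurable.Build default_measure_display
  gen_subgroup discrete_measurable discrete_measurable0
  discrete_measurableC discrete_measurableU.

Lemma countable_gen_subgroup : countable [set: gen_subgroup].
Proof.
pose f (l : seq (nat * bool)) : gen_subgroup := insubd 1%g (signed_word l).
apply: (@sub_countable _ _ _ (range f)); last first.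
  apply: card_le_trans (card_image_le _ _) _; exact: countableP.
apply: subset_card_le => x _; have /asboolP[l _ lx] := valP x.
by exists l => //; apply: val_inj; rewrite val_insubd lx (valP x).
Qed.

(** Countability is essential: the product of two discrete sigma-algebras on
    uncountable sets can fail to be discrete. *)
Lemma measurable_prod_gen_subgroup (A : set (gen_subgroup * gen_subgroup)) :
  measurable A.
Proof.
apply: countable_measurable => [[x y]|].
  rewrite (_ : [set (x, y)] = [set x] `*` [set y]); first exact: measurableX.
  by apply/seteqP; split => [[a b] [-> ->]|[a b] [/= -> ->]].
apply: sub_countable (subset_card_le (@subsetT _ A)) _.
rewrite -setXTT.
exact: countableX countable_gen_subgroup countable_gen_subgroup.
Qed.

Lemma gen_subgroup_measurable_mulg :
  measurable_fun [set: gen_subgroup * gen_subgroup]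
  (fun x : gen_subgroup * gen_subgroup => (x.1 * x.2)%g).
Proof. by move=> _ Y _; exact: measurable_prod_gen_subgroup. Qed.

Lemma gen_subgroup_measurable_invg : measurable_fun [set: gen_subgroup]
  (fun x : gen_subgroup => (x^-1)%g).
Proof. by []. Qed.

HB.instance Definition _ := @Measurable_isMeasurableGroup.Build
  default_measure_display gen_subgroup gen_subgroup_measurable_mulg
  gen_subgroup_measurable_invg I.

End countable_subgroup.

Section transfer.
Context {G : groupType} {d : measure_display} {Omega : measurableType d}
  {R : realType}.
Variable P : probability Omega R.

(** Dimension passes to the trace on a subgroup, since a nontrivial
    translation of the subgroup is a nontrivial translation of the group. *)
Lemma self_translate_dim_gen_subgroup (e : nat -> G) (C k : nat) (S : set G) :
  self_translate_dim C k S ->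
  measurable_self_translate_dim C k
    ((val : gen_subgroup e -> G) @^-1` S : set (gen_subgroup e)).
Proof.
elim: k S => [|k IH] S /=.
  apply: card_le_trans; apply: card_ge_preimage => x y _ _; exact: val_inj.
case=> T [-> dT]; exists (fun i => val @^-1` T i); split => // i g g1.
rewrite (_ : _ `&` _ = val @^-1` (T i `&` left_translate (val g) (T i))).
  by apply: IH; apply: dT; rewrite -(val1 (gen_subgroup e)) => /val_inj.
by rewrite !left_translateE preimage_setI; congr (_ `&` _).
Qed.

Lemma lift_to_gen_subgroup (e : nat -> G) (X : Omega -> G) :
  (forall w, range e (X w)) -> (forall g, measurable (X @^-1` [set g])) ->
  exists Y : {RV P >-> gen_subgroup e}, forall w, val (Y w) = X w.
Proof.
move=> Xe mX.
have Xgen w : generated e (X w).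
  apply/asboolP; have [n _ <-] := Xe w.
  by exists [:: (n, true)] => //; rewrite /signed_word big_seq1.
pose f w : gen_subgroup e := exist _ (X w) (Xgen w).
have mf : measurable_fun [set: Omega] f.
  move=> _ B _; rewrite setTI.
  rewrite (_ : f @^-1` B = \bigcup_h (f @^-1` (B `&` [set h]))); last first.
    by apply/seteqP; split => [w Bw|w [h _ []//]]; exists (f w).
  apply: countable_bigcupT_measurable => [|h].
    exact: countable_gen_subgroup.
  have [Bh|Bh] := pselect (B h); last first.
    rewrite (_ : _ @^-1` _ = set0)//; apply/seteqP; split => // w [/= Bw wh].
    by apply: Bh; rewrite -wh.
  rewrite (_ : _ @^-1` _ = X @^-1` [set val h]); first exact: mX.
  apply/seteqP; split => w /= => [[_ <-//]|wh].
  by have fwh : f w = h by [apply: val_inj]; rewrite fwh.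
pose mfY := isMeasurableFun.Build _ _ _ _ f mf.
pose Y : {mfun Omega >-> gen_subgroup e} := HB.pack f mfY.
by exists Y.
Qed.

Lemma lift_family_to_gen_subgroup (n : nat) (X : 'I_n -> Omega -> G) :
  (forall i, discrete_random_element (X i)) ->
  exists (e : nat -> G) (Y : 'I_n -> {RV P >-> gen_subgroup e}),
    forall i w, val (Y i w) = X i w.
Proof.
move=> dX.
have [e eX] : exists e : nat -> G,
    \bigcup_(i in [set: 'I_n]) range (X i) `<=` range e.
  have : countable (\bigcup_(i in [set: 'I_n]) range (X i)).
    by apply: bigcup_countable => // i _; have [] := dX i.
  move=> /pfcard_geP[->|[f]]; first by exists (fun=> 1%g).
  by exists f => x /(@surj _ _ _ _ f).
have /choice[Y YX] : forall i, exists Y : {RV P >-> gen_subgroup e},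
    forall w, val (Y w) = X i w.
  move=> i; apply: lift_to_gen_subgroup => [w|]; last by have [] := dX i.
  by apply: eX; exists i => //; exists w.
by exists e, Y.
Qed.

Section lifted.
Variables (e : nat -> G) (n : nat) (X : 'I_n -> Omega -> G).
Variable Y : 'I_n -> {RV P >-> gen_subgroup e}.
Hypothesis YX : forall i w, val (Y i w) = X i w.

Lemma lifted_ordered_product w :
  val (ordered_product Y w) = ordered_product X w.
Proof.
rewrite /ordered_product (big_morph val (@valM _ _ _) (@val1 _ _ _)).
by apply: eq_bigr => i _; rewrite YX.
Qed.

Lemma lifted_independent : independent_elements P [set: set G] X ->
  independent_elements P (@measurable _ (gen_subgroup e)) Y.
Proof.
move=> indX A _.
have YA i : Y i @^-1` A i = X i @^-1` [set val x | x in A i].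
  apply/seteqP; split => w /=.
    by move=> AY; exists (Y i w) => //; exact: YX.
  by case=> h Ah; rewrite -YX => /val_inj <-.
under eq_bigcapr do rewrite YA.
under eq_bigr do rewrite YA.
exact: indX.
Qed.

End lifted.

Section lifted_point_mass.
Variables (e : nat -> G) (X : Omega -> G) (Y : Omega -> gen_subgroup e).
Hypothesis YX : forall w, val (Y w) = X w.
Hypothesis mY : forall B : set (gen_subgroup e), measurable (Y @^-1` B).

Lemma lifted_point_mass h : point_mass P Y h = point_mass P X (val h).
Proof.
congr (fine (P _)); apply/seteqP; split => w /=; first by move=> <-; rewrite YX.
by rewrite -YX => /val_inj.
Qed.

Lemma max_point_mass_lift : max_point_mass P Y <= max_point_mass P X.
Proof.
apply: max_point_mass_le => // h.
rewrite -point_massE// lee_fin lifted_point_mass; apply: point_mass_le_max => g.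
rewrite (_ : X @^-1` _ = Y @^-1` (val @^-1` [set g]))//.
by apply/seteqP; split => w /=; rewrite YX.
Qed.

(** A probability measure on a countable set cannot vanish at every point. *)
Lemma exists_atom : exists h, point_mass P Y h != 0.
Proof.
apply: contrapT => /forallNP Y0.
have /pfcard_geP[/seteqP[/(_ 1%g I)//]|[f]] := @countable_gen_subgroup G e.
have YT : [set: Omega] = \bigcup_n Y @^-1` [set f n].
  apply/esym/seteqP; split => // w _.
  by have [n _ fn] := @surj _ _ _ _ f (Y w) I; exists n.
have Pf0 n : (P (Y @^-1` [set f n]) = 0)%E.
  rewrite -point_massE//; have /negP := Y0 (f n).
  by rewrite negbK => /eqP ->.
have : P.-negligible [set: Omega].
  rewrite YT; apply: negligible_bigcup => n.
  by apply/negligibleP => //; exact: Pf0.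
move=> /negligibleP PT.
have : (P [set: Omega] = 0)%E by exact: PT.
by rewrite probability_setT => /eqP; rewrite onee_eq0.
Qed.

End lifted_point_mass.

Section lifted_min.
Variables (e : nat -> G) (n : nat) (X : 'I_n -> Omega -> G).
Variable Y : 'I_n -> {RV P >-> gen_subgroup e}.
Hypothesis YX : forall i w, val (Y i w) = X i w.

Lemma min_point_mass_ge0 : 0 <= min_point_mass P X.
Proof.
have [E0|E0] := pselect ((\bigcup_(i in [set: 'I_n])
    (point_mass P (X i) @` supp P (X i))) = set0).
  by rewrite /min_point_mass E0 inf0.
apply: lb_le_inf; first by apply/set0P/eqP.
by move=> _ [i _ [g _ <-]]; apply: fine_ge0; exact: measure_ge0.
Qed.

Lemma min_point_mass_le_lift i : min_point_mass P X <= max_point_mass P (Y i).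
Proof.
have mY (B : set (gen_subgroup e)) : measurable (Y i @^-1` B).
  exact: measurable_funPTI.
have [h h0] := exists_atom mY.
apply: le_trans (point_mass_le_max P (fun g => mY [set g]) h).
rewrite (lifted_point_mass (YX i)) in h0 *.
apply: ge_inf; last by exists i => //; exists (val h).
by exists 0 => _ [j _ [g _ <-]]; apply: fine_ge0; exact: measure_ge0.
Qed.

Lemma min_point_mass_le1 (i : 'I_n) : min_point_mass P X <= 1.
Proof.
apply: le_trans (min_point_mass_le_lift i) _.
have mY g : measurable (Y i @^-1` [set g]) by exact: measurable_funPTI.
by apply: max_point_mass_le => // h; exact: probability_le1.
Qed.

End lifted_min.

End transfer.

Theorem theorem4 (R : realType) (C k : nat) (C_gt0 : (0 < C)%N) :
  exists K : R, 0 < K /\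
  [/\ forall (G : groupType) (S : set G), self_translate_dim C k S ->
      forall (d : measure_display) (Omega : measurableType d)
        (P : probability Omega R) (n : nat) (g : 'I_n -> Omega -> G),
      (0 < n)%N ->
      (forall i, discrete_random_element (g i)) ->
      independent_elements P [set: set G] g ->
      min_point_mass P g != 0 ->
      (P (ordered_product g @^-1` S) <=
       (K * ((min_point_mass P g)^-1 *
             max_point_mass P (ordered_product g) `^ (2 ^+ k.+1 - 1)^-1))%:E)%E,
      forall (G : groupType) (S : set G), self_translate_dim C k S ->
      forall (d : measure_display) (Omega : measurableType d)
        (P : probability Omega R) (X : 'I_k.+1 -> Omega -> G),
      (forall i, discrete_random_element (X i)) ->
      independent_elements P [set: set G] X ->
      (P (ordered_product X @^-1` S) <=
       (K * \big[Num.max/0]_(i < k.+1)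
              (max_point_mass P (X i) `^ (2 ^+ i)^-1))%:E)%E
    & forall (dG : measure_display) (G : measurableGroupType dG) (S : set G),
      measurable S -> measurable_self_translate_dim C k S ->
      forall (d : measure_display) (Omega : measurableType d)
        (P : probability Omega R) (X : 'I_k.+1 -> {RV P >-> G}),
      independent_elements P (@measurable dG G) X ->
      (P (ordered_product X @^-1` S) <=
       (K * \big[Num.max/0]_(i < k.+1)
              (max_point_mass P (X i) `^ (2 ^+ i)^-1))%:E)%E].
Proof.
set K := (dim_constant C k)%:R : R.
have K0 : 0 <= K by rewrite ler0n.
exists (1 + K); split; first by rewrite ltr_wpDr.
have weaken (x : R) : 0 <= x -> ((K * x)%:E <= ((1 + K) * x)%:E)%E.
  by move=> x0; rewrite lee_fin ler_wpM2r// lerDr.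
split.
- move=> G S dS d Omega P n g n0 dg indg p0.
  have [e [Y Yg]] := lift_family_to_gen_subgroup P dg.
  pose prodE : Omega -> gen_subgroup e := ordered_product Y.
  have mYe A : measurable (prodE @^-1` A).
    by rewrite -[X in measurable X]setTI; exact: measurable_ordered_product.
  have prodY := lifted_ordered_product Yg.
  have -> : ordered_product g @^-1` S = prodE @^-1` (val @^-1` S).
    by apply/seteqP; split => w /=; rewrite prodY.
  have p_gt0 : 0 < min_point_mass P g.
    by rewrite lt_neqAle eq_sym p0 min_point_mass_ge0.
  apply: le_trans.
    apply: (@ordered_product_le_total _ (gen_subgroup e) _ _ _ P C k n
      (val @^-1` S) Y (min_point_mass P g)).
    + by rewrite p_gt0 (min_point_mass_le1 Yg (Ordinal n0)).
    + by move=> i; exact: min_point_mass_le_lift.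
    + by [].
    + exact: self_translate_dim_gen_subgroup.
    + exact: lifted_independent indg.
  rewrite lee_fin; apply: ler_wpM2l; first exact: addr_ge0.
  apply: ler_wpM2l; first by rewrite invr_ge0 ltW.
  apply: ge0_ler_powR.
  + by rewrite invr_ge0 subr_ge0 exprn_ege1// ler1n.
  + by rewrite nnegrE; apply: max_point_mass_ge0 => h; exact: mYe.
  + rewrite nnegrE; apply: max_point_mass_ge0 => h.
    rewrite (_ : _ @^-1` _ = prodE @^-1` (val @^-1` [set h]))//.
    by apply/seteqP; split => w /=; rewrite prodY.
  + exact: max_point_mass_lift.
- move=> G S dS d Omega P X dX indX.
  have [e [Y YX]] := lift_family_to_gen_subgroup P dX.
  have -> : ordered_product X @^-1` S =
      (ordered_product Y : Omega -> gen_subgroup e) @^-1` (val @^-1` S).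
    by apply/seteqP; split => w /=; rewrite (lifted_ordered_product YX).
  apply: le_trans.
    apply: (@ordered_product_le_factors _ (gen_subgroup e) _ _ _ P C k
      (val @^-1` S) Y) => //.
    + exact: self_translate_dim_gen_subgroup.
    + exact: lifted_independent indX.
  apply: le_trans (weaken _ _); last exact: bigmax_ge_id.
  rewrite lee_fin; apply: ler_wpM2l => //.
  apply: le_bigmax2 => i _; apply: ge0_ler_powR.
  + by rewrite invr_ge0 exprn_ge0.
  + rewrite nnegrE; apply: max_point_mass_ge0 => h; exact: measurable_funPTI.
  + by rewrite nnegrE; apply: max_point_mass_ge0; have [] := dX i.
  + apply: max_point_mass_lift => // B; exact: measurable_funPTI.
- move=> dG G S mS dS d Omega P X indX.
  apply: le_trans (weaken _ _); last exact: bigmax_ge_id.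
  exact: ordered_product_le_factors.
Qed.
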